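(* Let $\lambda$ be a nonzero real number and let $F_{n,\lambda}(x)$ ($n\ge 0$) be the degenerate Fubini polynomials. Then for every integer $n\ge 0$, as an identity of rational functions in $x$, $$F_{n+1,\lambda}(x)=\frac{x}{1+x}\sum_{k=0}^{n}\binom{n}{k}\Big((1-\lambda)_{n-k,\lambda}F_{k,\lambda}(x)+(1)_{n-k,\lambda}F_{k+1,\lambda}(x)\Big).$$
   Context: For a nonzero real number $\lambda$: generalized falling factorials $(x)_{0,\lambda}=1$, $(x)_{n,\lambda}=x(x-\lambda)\cdots(x-(n-1)\lambda)$ for $n\ge 1$. With $(x)_0=1$ and $(x)_n=x(x-1)\cdots(x-n+1)$ for $n\ge 1$, the degenerate Stirling numbers of the second kind ${n \brace k}_{\lambda}$ ($0\le k\le n$) are defined by the polynomial identity $(x)_{n,\lambda}=\sum_{k=0}^{n}{n \brace k}_{\lambda}(x)_{k}$, $n\ge 0$. The degenerate Fubini polynomials are $F_{n,\lambda}(x)=\sum_{k=0}^{n}{n \brace k}_{\lambda}k!\,x^{k}$. An identity of rational functions in $x$ with denominator $1+x$ means equality for all real $x\neq -1$. *)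

(* Defs.v *)
From HB Require Import structures.
From mathcomp Require Import all_boot all_order all_algebra.
From mathcomp Require Import reals.
Set Implicit Arguments.
Unset Strict Implicit.
Unset Printing Implicit Defensive.
Import Order.TTheory GRing.Theory Num.Theory.
Local Open Scope ring_scope.

(* The ring A is arbitrary so that both can be used at a real number and at
   the indeterminate 'X. *)
Definition falling (A : comNzRingType) (x : A) (n : nat) : A :=
  \prod_(i < n) (x - i%:R).

Definition dfalling (A : comNzRingType) (l x : A) (n : nat) : A :=
  \prod_(i < n) (x - i%:R * l).

Lemma falling_monic_size (R : realType) (n : nat) :
  (falling ('X : {poly R}) n \is monic) /\
  size (falling ('X : {poly R}) n) = n.+1.
Proof.
have E : falling ('X : {poly R}) n = \prod_(i < n) ('X - (i%:R)%:P).
  by apply: eq_bigr => i _; rewrite polyC_natr.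
rewrite E; split; first exact: monic_prod_XsubC.
by rewrite size_prod_XsubC /index_enum -enumT size_enum_ord.
Qed.

Lemma falling_coords (R : realType) (n : nat) (p : {poly R}) :
  (size p <= n)%N ->
  exists a : nat -> R, p = \sum_(k < n) a k *: falling 'X k.
Proof.
elim: n p => [|n IHn] p; first by rewrite leqn0 size_poly_eq0 => /eqP->;
  exists (fun=> 0); rewrite big_ord0.
move=> hp; have [mon sz] := falling_monic_size R n.
have [|a ha] := IHn (p - p`_n *: falling 'X n).
  apply/leq_sizeP => j; rewrite leq_eqVlt coefB coefZ => /orP[/eqP<-|ltnj].
    have -> : (falling ('X : {poly R}) n)`_n = 1.
      by move/monicP: mon; rewrite lead_coefE sz.
    by rewrite mulr1 subrr.
  rewrite (nth_default 0 (leq_trans hp ltnj)) sub0r.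
  rewrite (@nth_default _ 0 (falling 'X n)) ?sz //.
  by rewrite mulr0 oppr0.
exists (fun k => if k == n then p`_n else a k).
rewrite big_ord_recr /= eqxx.
apply/(canRL (subrK _)); rewrite ha.
by apply: eq_bigr => k _; rewrite ltn_eqF ?ltn_ord.
Qed.

Lemma falling_free (R : realType) (n : nat) (a : nat -> R) :
  \sum_(k < n) a k *: falling ('X : {poly R}) k = 0 ->
  forall k, (k < n)%N -> a k = 0.
Proof.
elim: n => [|n IHn] // h.
have [mon sz] := falling_monic_size R n.
have an0 : a n = 0.
  have := congr1 (fun p : {poly R} => p`_n) h.
  rewrite big_ord_recr /= coefD coef_sum big1 ?add0r.
    rewrite coefZ coef0; move/monicP: mon; rewrite lead_coefE sz /= => ->.
    by rewrite mulr1.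
  move=> k _; rewrite coefZ nth_default ?mulr0 //.
  by have [_ ->] := falling_monic_size R k.
move=> k; rewrite ltnS leq_eqVlt => /orP[/eqP->//|]; apply: IHn.
by move: h; rewrite big_ord_recr /= an0 scale0r addr0.
Qed.

Lemma dstirling2_exists (R : realType) (lam : R) (n : nat) :
  exists a : {ffun 'I_n.+1 -> R},
    dfalling lam%:P 'X n == \sum_(k < n.+1) a k *: falling 'X k.
Proof.
have [|a ha] := @falling_coords R n.+1 (dfalling lam%:P 'X n).
  rewrite /dfalling (eq_bigr (fun i : 'I_n => 'X - (i%:R * lam)%:P)).
    by rewrite size_prod_XsubC /index_enum -enumT size_enum_ord.
  by move=> i _; rewrite polyCM polyC_natr.
exists [ffun k : 'I_n.+1 => a k]; rewrite ha; apply/eqP.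
by apply: eq_bigr => k _; rewrite ffunE.
Qed.

(* The coefficients of (X)_{n,lam} in the basis (X)_0, ..., (X)_n; they exist
   by [dstirling2_exists] and are unique by [dstirling2_unique]. Values with
   k > n are set to 0. *)
Definition dstirling2 (R : realType) (lam : R) (n k : nat) : R :=
  if insub k is Some i then xchoose (dstirling2_exists lam n) i else 0.

Lemma dstirling2_def (R : realType) (lam : R) (n : nat) :
  dfalling lam%:P 'X n =
  \sum_(k < n.+1) dstirling2 lam n k *: falling 'X k :> {poly R}.
Proof.
rewrite (eqP (xchooseP (dstirling2_exists lam n))).
by apply: eq_bigr => k _; rewrite /dstirling2 valK.
Qed.

Lemma dstirling2_unique (R : realType) (lam : R) (n : nat) (a : nat -> R) :
  dfalling lam%:P 'X n =
    \sum_(k < n.+1) a k *: falling 'X k :> {poly R} ->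
  forall k, (k <= n)%N -> a k = dstirling2 lam n k.
Proof.
rewrite dstirling2_def => h k lekn; apply/eqP; rewrite -subr_eq0; apply/eqP.
apply: (@falling_free R n.+1 (fun k => a k - dstirling2 lam n k)) => //.
rewrite (eq_bigr (fun k : 'I_n.+1 =>
  a k *: falling 'X k - dstirling2 lam n k *: falling 'X k)).
  by rewrite sumrB h subrr.
by move=> i _; rewrite scalerBl.
Qed.

Definition dfubini (R : realType) (lam : R) (n : nat) : {poly R} :=
  \sum_(k < n.+1) (dstirling2 lam n k * (k`!)%:R) *: 'X^k.

(* Main.v *)
Require Import Defs.
From HB Require Import structures.
From mathcomp Require Import all_boot all_order all_algebra.
From mathcomp Require Import reals ring.
Import Order.TTheory GRing.Theory Num.Theory.
Local Open Scope ring_scope.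

(** Let [D p = p(X + 1) - p] and let [L p] be the sum over [k] of
    [x ^+ k * (D^k p)(0)].  Since [D (X)_(k+1) = (k+1) (X)_k], this linear form
    sends [(X)_k] to [k! x^k], so it sends [(X)_(n,lam)] to the value at [x] of
    the [n]-th degenerate Fubini polynomial ([newton_form_dfalling]).  By
    construction [x L(D p) = L p - p(0)], that is,
      [x L(p(X + 1)) = (1 + x) L p - p(0)].
    Taking [p = (X)_(n+1,lam)], which vanishes at [0], it only remains to apply
    [L] to the expansion of [(X + 1)_(n+1,lam) = (X + 1) (X + 1 - lam)_(n,lam)].
    The degenerate Vandermonde identity [dfalling_add] expands
    [(X + 1 - lam)_(n,lam)] once as [((1 - lam) + X)_(n,lam)] and once as
    [(1 + (X - lam))_(n,lam)]; the latter is used for the summand with the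
    factor [X], which turns [(X - lam)_(k,lam)] into [(X)_(k+1,lam)]
    ([dfalling_shift_expansion]). *)

Section Dfalling.

Variable A : comNzRingType.
Implicit Types l x y : A.

Lemma fallingE x n : falling x n = dfalling 1 x n.
Proof. by apply: eq_bigr => i _; rewrite mulr1. Qed.

Lemma dfalling0 l x : dfalling l x 0 = 1.
Proof. exact: big_ord0. Qed.

Lemma dfallingSr l x n : dfalling l x n.+1 = dfalling l x n * (x - n%:R * l).
Proof. exact: big_ord_recr. Qed.

Lemma dfallingSl l x n : dfalling l x n.+1 = x * dfalling l (x - l) n.
Proof.
rewrite /dfalling big_ord_recl /= mul0r subr0; congr (_ * _).
by apply: eq_bigr => i _; rewrite -natr1; ring.
Qed.

Lemma rmorph_dfalling (B : comNzRingType) (f : {rmorphism A -> B}) l x n :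
  f (dfalling l x n) = dfalling (f l) (f x) n.
Proof.
rewrite rmorph_prod; apply: eq_bigr => i _.
by rewrite rmorphB rmorphM rmorph_nat.
Qed.

(** The degenerate Chu-Vandermonde identity. *)
Lemma dfalling_add l x y n :
  dfalling l (x + y) n =
  \sum_(k < n.+1) 'C(n, k)%:R * (dfalling l x (n - k) * dfalling l y k).
Proof.
elim: n x y => [|n IHn] x y.
  by rewrite big_ord1 bin0 !dfalling0 !mulr1.
rewrite dfallingSl mulrDl -[in y * _]addrA addrAC !IHn.
rewrite [RHS]big_ord_recl /= bin0 subn0.
(* Pascal's rule splits the sum according to which of x and y is the leading
   factor; the former part lacks only its term of index 0, and its term of
   index n.+1 is zero. *)
under [X in _ = _ + X]eq_bigr => k _ do
  rewrite /bump /= add1n subSS binS natrD mulrDl.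
rewrite big_split /= addrA; congr (_ + _).
  rewrite [X in _ = _ + X]big_ord_recr /= bin_small // mul0r addr0.
  rewrite big_ord_recl /= bin0 subn0 !mulrDr; congr (_ + _).
    by rewrite !dfalling0 dfallingSl; ring.
  rewrite mulr_sumr; apply: eq_bigr => k _.
  rewrite /bump /= add1n -(subnSK (ltn_ord k)) [dfalling l x _]dfallingSl; ring.
rewrite mulr_sumr; apply: eq_bigr => k _.
by rewrite [dfalling l y k.+1]dfallingSl; ring.
Qed.

Lemma dfalling_shift_expansion l x n :
  dfalling l (x + 1) n.+1 =
  \sum_(k < n.+1) 'C(n, k)%:R *
    (dfalling l (1 - l) (n - k) * dfalling l x k +
     dfalling l 1 (n - k) * dfalling l x k.+1).
Proof.
under eq_bigr => k _ do rewrite mulrDr.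
rewrite big_split /= -dfalling_add.
under [X in _ = _ + X]eq_bigr => k _ do
  rewrite [dfalling l x k.+1]dfallingSl (mulrCA _ x) (mulrCA _ x).
rewrite -mulr_sumr -dfalling_add dfallingSl.
have -> : 1 - l + x = x + 1 - l by ring.
have -> : 1 + (x - l) = x + 1 - l by ring.
ring.
Qed.

End Dfalling.

Section NewtonForm.

Variable R : realType.
Implicit Types (lam x : R) (p q : {poly R}).

(** The forward difference [p(X + 1) - p(X)]. *)
Definition fdiff p : {poly R} := p \Po ('X + 1) - p.

(** The linear form sending [p] to the sum over [k < N] of
    [x ^+ k * (fdiff^k p)(0)].  For [N >= size p] no nonzero term is lost; the
    bound [N] keeps the sum finite uniformly in [p]. *)
Fixpoint newton_form (N : nat) x p : R :=
  if N is N'.+1 then p.[0] + x * newton_form N' x (fdiff p) else 0.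

Lemma fdiff_is_linear : linear fdiff.
Proof. by move=> a p q; rewrite /fdiff linearP scalerBr opprD addrACA. Qed.

HB.instance Definition _ :=
  GRing.isLinear.Build R {poly R} {poly R} _ fdiff fdiff_is_linear.

Lemma newton_form_is_scalar N x : scalar (newton_form N x).
Proof.
elim: N => [|N IHN] a p q /=; first by rewrite mulr0 addr0.
by rewrite linearP IHN hornerD hornerZ /=; ring.
Qed.

HB.instance Definition _ N x :=
  GRing.isLinear.Build R {poly R} R _ (newton_form N x)
    (newton_form_is_scalar N x).

Lemma newton_form_shift N x p :
  x * newton_form N x (p \Po ('X + 1)) =
  x * newton_form N x p + newton_form N.+1 x p - p.[0].
Proof.
have -> : p \Po ('X + 1) = p + fdiff p by rewrite [RHS]addrC subrK.
by rewrite linearD /=; ring.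
Qed.

Lemma fdiff_falling k : fdiff (falling 'X k.+1) = k.+1%:R *: falling 'X k.
Proof.
rewrite /fdiff !fallingE (rmorph_dfalling _ _ (comp_poly ('X + 1))) /=.
rewrite rmorph1 comp_polyX dfallingSl dfallingSr addrK scaler_nat.
by rewrite -[RHS]mulr_natl -[k.+1%:R]natr1; ring.
Qed.

Lemma newton_form_falling N x k : (k < N)%N ->
  newton_form N x (falling 'X k) = k`!%:R * x ^+ k.
Proof.
elim: k N => [|k IHk] [|N] //= ltkN.
  rewrite fallingE dfalling0 /fdiff rmorph1 subrr linear0 hornerC.
  by rewrite mulr0 addr0 mulr1.
rewrite fdiff_falling linearZ /= IHk // fallingE dfallingSl hornerM hornerX.
by rewrite mul0r add0r factS natrM exprS; ring.
Qed.

Lemma newton_form_dfalling N lam x n : (n < N)%N ->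
  newton_form N x (dfalling lam%:P 'X n) = (dfubini lam n).[x].
Proof.
move=> ltnN; rewrite dstirling2_def linear_sum horner_sum.
apply: eq_bigr => k _; rewrite linearZ /= newton_form_falling.
  by rewrite hornerZ hornerXn mulrA.
exact: leq_ltn_trans (leq_ord k) ltnN.
Qed.

End NewtonForm.

Arguments newton_form : simpl never.

Theorem theorem2p13 (R : realType) (lam : R) (hlam : lam != 0) (n : nat)
    (x : R) (hx : x != -1) :
  (dfubini lam n.+1).[x] =
  x / (1 + x) *
  \sum_(k < n.+1) 'C(n, k)%:R *
    (dfalling lam (1 - lam) (n - k) * (dfubini lam k).[x] +
     dfalling lam 1 (n - k) * (dfubini lam k.+1).[x]).
Proof.
have x1_neq0 : 1 + x != 0 by rewrite addrC addr_eq0.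
have shiftE : newton_form R n.+2 x (dfalling lam%:P ('X + 1) n.+1) =
    \sum_(k < n.+1) 'C(n, k)%:R *
      (dfalling lam (1 - lam) (n - k) * (dfubini lam k).[x] +
       dfalling lam 1 (n - k) * (dfubini lam k.+1).[x]).
  rewrite dfalling_shift_expansion linear_sum; apply: eq_bigr => k _.
  (* The coefficients are constant polynomials, hence scalars for the form. *)
  rewrite -polyC1 -polyCB -!(rmorph_dfalling _ _ polyC) -polyC_natr !mul_polyC.
  rewrite linearZ linearD !linearZ /= !newton_form_dfalling //.
    by rewrite ltnS ltn_ord.
  exact: ltnW (ltn_ord k).
have := newton_form_shift _ n.+2 x (dfalling lam%:P 'X n.+1).
rewrite (rmorph_dfalling _ _ (comp_poly ('X + 1))) /= comp_polyC comp_polyX.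
rewrite shiftE !newton_form_dfalling //.
rewrite dfallingSl hornerM hornerX mul0r subr0 => sumE.
by rewrite mulrAC sumE; field.
Qed.
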